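(* Suppose there exist positive definite matrices $\mathcal{S},Q$ in the space of real symmetric matrices of order $2n$ satisfying the linear matrix inequality $$\begin{bmatrix} A_0\mathcal{S}+\mathcal{S}A_0^{\mathrm{T}}+Q & \mathcal{S} & \widetilde{A}\\ \mathcal{S} & -I_{2n} & 0\\ \widetilde{A}^{\mathrm{T}} & 0 & -\frac{1}{2d}I_{4nd}\end{bmatrix}\preccurlyeq 0,$$ where $\widetilde{A}:=\begin{bmatrix}A_{-d}&\ldots&A_{-1}&A_1&\ldots&A_d\end{bmatrix}\in\mathbb{R}^{2n\times 4nd}$. Then the network is stable in the sense that $$\max_{z\in\mathbb{U}}\mathbf{r}(\mathrm{e}^{\mathcal{A}_z})<1,\qquad \mathcal{A}_z:=\sum_{k=-d}^{d}A_kz^{-k}.$$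
   Context: Notation: $\mathbf{r}(\cdot)$ is the spectral radius; $\mathbb{U}=\{z\in\mathbb{C}:|z|=1\}$; $i=\sqrt{-1}$; $\preccurlyeq 0$ means negative semi-definite. Network matrices: let $d\geqslant 1$ and $n,m\geqslant 1$ be integers, $\Theta$ a nonsingular real antisymmetric matrix of order $2n$ (the canonical commutation matrix of each node), $R_\ell=R_{-\ell}^{\mathrm{T}}\in\mathbb{R}^{2n\times 2n}$ for $\ell=0,\pm1,\ldots,\pm d$ (energy matrices), $M\in\mathbb{R}^{2m\times 2n}$ (coupling matrix), $J=I_m\otimes\begin{bmatrix}0&1\\-1&0\end{bmatrix}$, and $B=2\Theta M^{\mathrm{T}}$. Define $$A_0=2\Theta R_0-\tfrac12 BJB^{\mathrm{T}}\Theta^{-1},\qquad A_\ell=2\Theta R_\ell\quad(0<|\ell|\leqslant d).$$ These are the coefficient matrices of the translation invariant network (interaction range $d$, any fragment length $N>2d$, periodic boundary conditions) governed by the linear quantum stochastic differential equations $\mathrm{d}X_j=\sum_{\ell=-d}^{d}A_\ell X_{\mathrm{mod}(j-\ell,N)}\,\mathrm{d}t+B\,\mathrm{d}W_j$, $j=0,\ldots,N-1$, where $X_j$ is the $2n$-dimensional vector of dynamic variables of the $j$th node and $W_j$ are vectors of quantum Wiener processes. Stability of the network is by definition the spectral radius condition displayed in the claim (equivalently, $\mathcal{A}_z$ is Hurwitz for all $z\in\mathbb{U}$). *)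

(* Defs.v *)
From mathcomp Require Import all_boot all_order all_algebra.
From mathcomp Require Import all_classical all_reals all_analysis.
From mathcomp Require Import complex mxtens.
Import Order.TTheory GRing.Theory Num.Theory numFieldNormedType.Exports.

Set Implicit Arguments.
Unset Strict Implicit.
Unset Printing Implicit Defensive.

Local Open Scope classical_set_scope.
Local Open Scope ring_scope.

Definition posdefmx (R : realType) n (S : 'M[R]_n) : Prop :=
  S^T = S /\ forall x : 'cV[R]_n, x != 0 -> 0 < (x^T *m S *m x) 0 0.

Definition negsemidefmx (R : realType) n (S : 'M[R]_n) : Prop :=
  S^T = S /\ forall x : 'cV[R]_n, (x^T *m S *m x) 0 0 <= 0.

(* The regular module [R[i]^o] carries the usual topology of the complex plane,
   and the limit is taken in the induced entrywise topology on matrices. *)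
Definition expmx (R : realType) n (A : 'M[R[i]]_n) : 'M[R[i]]_n :=
  limn (series (fun k => k`!%:R^-1 *: (A ^+ k) : 'M[R[i]^o]_n)).

(* The set is finite, and nonempty as soon as [0 < n], so that the supremum is
   the maximal modulus of an eigenvalue. *)
Definition spectral_radius (R : realType) n (A : 'M[R[i]]_n) : R :=
  sup [set Normc.normc l | l in [set l | eigenvalue A l]].

Definition is_maximum (R : realType) (E : set R) (mu : R) : Prop :=
  E mu /\ ubound E mu.

Section Network.
Variables (R : realType) (n m : nat).

(* The order 2n is written [n * 2], which is the order of [1%:M *t _] for a
   2 x 2 right factor. *)
Definition Jmx : 'M[R]_(m * 2) :=
  1%:M *t (block_mx 0 1%:M (- 1%:M) 0 : 'M[R]_(1 + 1)).

Variables (Theta : 'M[R]_(n * 2)) (E : int -> 'M[R]_(n * 2)).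
Variable M : 'M[R]_(m * 2, n * 2).

Definition Bmx : 'M[R]_(n * 2, m * 2) := 2 *: (Theta *m M^T).

(* [E l] is the energy matrix R_l. Only the values at |l| <= d are used. *)
Definition Amx (l : int) : 'M[R]_(n * 2) :=
  if l == 0
  then 2 *: (Theta *m E 0) - 2^-1 *: (Bmx *m Jmx *m Bmx^T *m invmx Theta)
  else 2 *: (Theta *m E l).

End Network.

Section Coefficients.
Variables (R : realType) (p d : nat) (A : int -> 'M[R]_p).

(* [A_(-d) ... A_(-1) A_1 ... A_d], of width 2dp. *)
Definition Atilde :=
  row_mx (\mxrow_(j < d) A (j%:Z - d%:Z)) (\mxrow_(j < d) A j.+1%:Z).

Definition lmimx (S Q : 'M[R]_p) :=
  block_mx
    (block_mx (A 0 *m S + S *m (A 0)^T + Q) S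
              S                             (- 1%:M))
    (col_mx Atilde 0)
    (row_mx Atilde^T 0)
    (- (2 * d%:R)^-1%:M).

Definition symbolmx (z : R[i]) : 'M[R[i]]_p :=
  \sum_(j < (2 * d).+1)
    let k := j%:Z - d%:Z in z ^ (- k) *: map_mx (real_complex R) (A k).

(* The maximum over the unit circle is required to be attained. *)
Definition network_stable : Prop :=
  exists2 mu : R,
    is_maximum [set spectral_radius (expmx (symbolmx z)) | z in
                 [set z : R[i] | `|z| = 1]] mu
    & mu < 1.

End Coefficients.

(* Main.v *)
(* Fix [z] on the unit circle, let [v A_z = l v], let [C] be the part of [A_z]
   with [k <> 0], and put [u = v C]. Evaluating the matrix inequality at the
   complex vector [(v, u, (z^k u)_k)] gives exactly
   [v (A_z S + S A_z^H + Q) v^H <= 0], hence [2 Re l (v S v^H) <= - v Q v^H],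
   and so [Re l < 0], where [^H] is the conjugate transpose.

   The eigenvalues of [exp A_z] have the moduli [exp (Re l)]: an eigenspace of
   [exp A_z] is stable under [A_z] and so contains an eigenvector of [A_z].
   Finally the pairs [(z, l)] with [|z| = 1] and [l] an eigenvalue of [A_z]
   form a compact set, on which [Re l] attains its maximum. *)

Require Import Defs.
From mathcomp Require Import all_boot all_order all_algebra.
From mathcomp Require Import all_classical all_reals all_analysis.
From mathcomp Require Import complex mxtens.
From mathcomp Require Import ring.
Import Order.TTheory GRing.Theory Num.Theory numFieldNormedType.Exports.
Set Implicit Arguments.
Unset Strict Implicit.
Unset Printing Implicit Defensive.
Local Open Scope classical_set_scope.
Local Open Scope ring_scope.

(** * Products of partial sums of the exponential series *)

Section ExpSeries.

Definition expterm (K : numFieldType) (x : K) (k : nat) : K := x ^+ k / k`!%:R.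

(** The pairs with [i + j < N] form a triangle. Passing from [N] to [N.+1] adds the antidiagonal
    [i + j = N], which is the binomial expansion of [expterm (x + y) N]. *)
Lemma series_expD (K : numFieldType) (x y : K) N :
  series (expterm (x + y)) N =
  \sum_(0 <= i < N) \sum_(0 <= j < N - i) expterm x i * expterm y j.
Proof.
elim: N => [|N IH]; first by rewrite seriesEnat/= !big_geq.
rewrite seriesSr IH [RHS]big_nat_recr//= subSn// subnn big_nat1.
under [in RHS]eq_big_nat => i /andP[_ iN].
  rewrite subSn ?(ltnW iN)// big_nat_recr//=; over.
rewrite big_split/= -addrA; congr (_ + _).
transitivity (\sum_(0 <= i < N.+1) expterm x i * expterm y (N - i)); last first.
  by rewrite big_nat_recr//= subnn.
rewrite /expterm addrC exprDn big_mkord mulr_suml; apply: eq_bigr => i _.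
have iN : (i <= N)%N by rewrite -ltnS.
rewrite -mulrnAr -mulr_natr -(bin_fact iN) !natrM.
have f0 k : k`!%:R != 0 :> K by rewrite pnatr_eq0 -lt0n fact_gt0.
have b0 : 'C(N, i)%:R != 0 :> K by rewrite pnatr_eq0 -lt0n bin_gt0.
by field; rewrite !f0 b0.
Qed.

(** The product sums over a square and [series_expD] over the triangle inside it; the complementary
    corner remains. *)
Lemma series_expM_sub (K : numFieldType) (x y : K) N :
  series (expterm x) N * series (expterm y) N - series (expterm (x + y)) N
  = \sum_(0 <= i < N) \sum_(N - i <= j < N) expterm x i * expterm y j.
Proof.
rewrite series_expD [X in X * _ - _]/series/= mulr_suml -sumrB.
apply: eq_big_nat => i /andP[_ iN]; rewrite [series _ N]/series/= mulr_sumr.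
by rewrite (big_cat_nat (n := N - i))//= ?leq_subr// [LHS]addrAC subrr add0r.
Qed.

(** The corner consists of monomials with nonnegative coefficients, so the triangle inequality
    replaces [x] and [y] by their moduli. *)
Lemma norm_series_expM_sub (K : numFieldType) (x y : K) N :
  `|series (expterm x) N * series (expterm y) N
    - series (expterm (x + y)) N|
  <= series (expterm `|x|) N * series (expterm `|y|) N
     - series (expterm (`|x| + `|y|)) N.
Proof.
rewrite !series_expM_sub; apply: le_trans (ler_norm_sum _ _ _) _.
apply: ler_sum => i _; apply: le_trans (ler_norm_sum _ _ _) _.
apply: ler_sum => j _.
by rewrite /expterm !normrM !normrX !normfV !normr_nat.
Qed.

Lemma series_expR_cvg (R : realType) (x : R) :
  series (expterm x) @ \oo --> expR x.
Proof. exact: is_cvg_series_exp_coeff. Qed.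

Lemma series_expRM_sub_cvg0 (R : realType) (x y : R) :
  series (expterm x) N * series (expterm y) N
    - series (expterm (x + y)) N @[N --> \oo] --> (0 : R).
Proof.
rewrite -(subrr (expR (x + y))) {1}expRD.
by apply: cvgB; [apply: cvgM|]; exact: series_expR_cvg.
Qed.
End ExpSeries.

(** * Complex limits and the modulus of the complex exponential *)

Section ComplexLimits.
Variable R : realType.
Implicit Types z : R[i].

Lemma normc_real (x : R) : `|x%:C%C| = `|x|%:C%C :> R[i].
Proof. by rewrite normc_def/= expr0n/= addr0 sqrtr_sqr. Qed.

Lemma real_complex_continuous : continuous (real_complex R : R -> R[i]^o).
Proof.
(* A positive element of [R[i]] has zero imaginary part, so the tolerance is a real number. *)
move=> x; apply/cvgrPdist_lt => -[e e'] /=; rewrite ltcE/= => /andP[/eqP-> e0].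
near=> y; rewrite -rmorphB/= normc_real ltcR.
by near: y; exact: (@cvgr_dist_lt _ _ _ (nbhs x) _ id x).
Unshelve. all: by end_near. Qed.

Lemma complex_cvg (u : nat -> R[i]) (a b : R) :
  complex.Re (u n) @[n --> \oo] --> a -> complex.Im (u n) @[n --> \oo] --> b ->
  (u : nat -> R[i]^o) @ \oo --> ((a +i* b)%C : R[i]^o).
Proof.
move=> ua ub; rewrite [(a +i* b)%C]complexE/=.
under eq_cvg do rewrite [u _]complexE.
have toC (v : nat -> R) (c : R) : v @ \oo --> c ->
    ((v n)%:C%C : R[i]^o) @[n --> \oo] --> (c%:C%C : R[i]^o).
  by move=> vc; apply: continuous_cvg => //; exact: real_complex_continuous.
apply: cvgD; first exact: toC.
by apply: cvgM; [exact: cvg_cst|exact: toC].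
Qed.

(** Real and imaginary parts are each dominated by the convergent real exponential series at [c]. *)
Lemma series_complex_cvg (u : nat -> R[i]) (c : R) :
  (forall k, `|u k| <= (expterm c k)%:C%C) ->
  cvgn (series u : nat -> R[i]^o).
Proof.
move=> uc.
have cvg_real (v : nat -> R) : (forall k, `|v k| <= expterm c k) ->
    cvgn (series v).
  move=> vc; apply: normed_cvg; apply: (series_le_cvg _ _ vc) => //.
  - by move=> k; apply: le_trans (vc k).
  - exact: is_cvg_series_exp_coeff.
have re : cvgn (series (fun k => complex.Re (u k))).
  apply: cvg_real => k; rewrite -lecR; apply: le_trans (uc k).
  exact: normc_ge_Re.
have im : cvgn (series (fun k => complex.Im (u k))).
  apply: cvg_real => k; rewrite -lecR; apply: le_trans (uc k).
  (* Up to sign, the imaginary part of [u k] is the real part of [u k * 'i]. *)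
  have := normc_ge_Re (u k * 'i%C); rewrite ReiNIm normrN normrM.
  by rewrite [`|'i%C|]normc_def/= expr0n/= expr1n add0r sqrtr1 mulr1.
apply/cvg_ex; exists ((limn (series (fun k => complex.Re (u k))) +i*
                       limn (series (fun k => complex.Im (u k))))%C : R[i]^o).
apply: complex_cvg.
- rewrite (_ : (fun n => _) = series (fun k => complex.Re (u k))) //.
  by apply/funext => n; rewrite /series/= (raddf_sum (@complex.Re R)).
- rewrite (_ : (fun n => _) = series (fun k => complex.Im (u k))) //.
  by apply/funext => n; rewrite /series/= (raddf_sum (@complex.Im R)).
Qed.

(* By conjugation, [|E_N(z)|^2 = E_N(z) E_N(conj z)] for the partial sums [E_N],
   and the product is close to [E_N(2 Re z)]; the error is dominated by the same
   expression at [|z|], where it tends to 0 because the real exponential is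
   known to be multiplicative. *)
Lemma norm_exp_limit z (l : R[i]^o) :
  (series (expterm z) : nat -> R[i]^o) @ \oo --> l ->
  Normc.normc l = expR (complex.Re z).
Proof.
move=> zl.
have conjE N : series (expterm (z^*)%C) N = (series (expterm z) N)^*%C.
  rewrite /series/= rmorph_sum; apply: eq_bigr => k _.
  by rewrite /expterm rmorphM rmorphXn fmorphV rmorph_nat.
have realE (x : R) N : series (expterm x%:C%C) N = (series (expterm x) N)%:C%C.
  rewrite /series/= rmorph_sum; apply: eq_bigr => k _.
  by rewrite /expterm rmorphM rmorphXn fmorphV rmorph_nat.
have sq_cvg : (`|series (expterm z) N| ^+ 2 : R[i]^o) @[N --> \oo]
    --> (`|l| ^+ 2 : R[i]^o).
  by rewrite expr2; under eq_cvg do rewrite expr2; apply: cvgM; exact: cvg_norm.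
have exp_cvg :
    ((series (expterm (complex.Re z *+ 2)) N)%:C%C : R[i]^o) @[N --> \oo]
    --> ((expR (complex.Re z *+ 2))%:C%C : R[i]^o).
  apply: continuous_cvg; first exact: real_complex_continuous.
  exact: series_expR_cvg.
have dist N : `|(`|series (expterm z) N| ^+ 2 : R[i]) -
    (series (expterm (complex.Re z *+ 2)) N)%:C%C| <=
    (series (expterm (Normc.normc z)) N * series (expterm (Normc.normc z)) N
     - series (expterm (Normc.normc z + Normc.normc z)) N)%:C%C.
  (* Abstracting the partial sums keeps unification from unfolding them. *)
  have abstract_sums (EC : R[i] -> R[i]) (ER : R -> R) :
      EC (z^*)%C = (EC z)^*%C -> (forall x, EC x%:C%C = (ER x)%:C%C) ->
      `|EC z * EC (z^*)%C - EC (z + (z^*)%C)| <=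
        EC `|z| * EC `|(z^*)%C| - EC (`|z| + `|(z^*)%C|) ->
      `|(`|EC z| ^+ 2 : R[i]) - (ER (complex.Re z *+ 2))%:C%C| <=
        (ER (Normc.normc z) * ER (Normc.normc z)
         - ER (Normc.normc z + Normc.normc z))%:C%C.
    move=> EC_conj EC_real; have zE : `|z| = (Normc.normc z)%:C%C by [].
    rewrite EC_conj -sqr_normc addcJ mulr_natl -rmorphMn/= normcJ zE.
    rewrite -(rmorphD (real_complex R) (Normc.normc z)) !EC_real.
    by rewrite rmorphB rmorphM.
  exact: (abstract_sums (fun x => series (expterm x) N)
    (fun x => series (expterm x) N) (conjE N) (realE ^~ N)
    (norm_series_expM_sub z (z^*)%C N)).
have d0 : (`|series (expterm z) N| ^+ 2 -
    (series (expterm (complex.Re z *+ 2)) N)%:C%C : R[i]^o) @[N --> \oo] --> (0 : R[i]^o).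
  apply/cvgr0Pnorm_lt => -[e e'] /=; rewrite ltcE/= => /andP[/eqP-> e0].
  near=> N; apply: le_lt_trans (dist N) _; rewrite ltcR.
  apply: le_lt_trans (ler_norm _) _; near: N.
  have := series_expRM_sub_cvg0 (Normc.normc z) (Normc.normc z).
  by move/cvgr0Pnorm_lt; exact.
(* Two limits of one sequence agree, so the squares of [|l|] and of [expR (Re z)] are equal, and
   both numbers are nonnegative. *)
have /eqP : `|l| ^+ 2 - (expR (complex.Re z *+ 2))%:C%C = 0 :> R[i].
  exact: (norm_cvg_unique (cvgB sq_cvg exp_cvg) d0).
rewrite subr_eq0 mulr2n expRD -expr2 rmorphXn/=.
rewrite (_ : `|l| = (Normc.normc l)%:C%C) // -!rmorphXn/= => /eqP/complexI/eqP.
rewrite eqrXn2 ?expR_ge0//; first by move/eqP.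
by case: (l) => *; exact: sqrtr_ge0.
Unshelve. all: by end_near. Qed.

End ComplexLimits.

(** * An entrywise norm that bounds powers and eigenvalues *)

Section MatrixNorm.
Variable K : numDomainType.

(** A sum rather than a maximum of row sums keeps the bounds meaningful over [R[i]], whose order is
    only partial. *)
Definition mxnorm1 m n (A : 'M[K]_(m, n)) : K := \sum_i \sum_j `|A i j|.

Lemma mxnorm1_ge0 m n (A : 'M[K]_(m, n)) : 0 <= mxnorm1 A.
Proof. by do 2![apply: sumr_ge0 => ? _]. Qed.

Lemma row_le_mxnorm1 m n (A : 'M[K]_(m, n)) i : \sum_j `|A i j| <= mxnorm1 A.
Proof.
rewrite /mxnorm1 (bigD1 i)//= lerDl; apply: sumr_ge0 => k _.
exact: sumr_ge0.
Qed.

Lemma entry_exprmx_le p (A : 'M[K]_p) k i j : `|(A ^+ k) i j| <= mxnorm1 A ^+ k.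
Proof.
elim: k j => [|k IH] j.
  by rewrite !expr0 mxE; case: eqP; rewrite ?normr1 ?normr0 ?ler01.
rewrite !exprSr mxE; apply: le_trans (ler_norm_sum _ _ _) _.
apply: (@le_trans _ _ (\sum_l mxnorm1 A ^+ k * `|A l j|)).
  by apply: ler_sum => l _; rewrite normrM ler_wpM2r.
rewrite -mulr_sumr ler_wpM2l ?exprn_ge0 ?mxnorm1_ge0//.
apply: ler_sum => l _; rewrite (bigD1 j)//= lerDl; exact: sumr_ge0.
Qed.
End MatrixNorm.

(** Take moduli in [v *m A = l *: v], sum over the columns, and divide by the positive sum of the
    moduli of the entries of [v]. *)
Lemma norm_eigenvalue_le (K : numFieldType) p (A : 'M[K]_p) l :
  eigenvalue A l -> `|l| <= mxnorm1 A.
Proof.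
move=> /eigenvalueP[v vA v0].
have v_gt0 : 0 < \sum_j `|v 0 j|.
  have [j vj] : exists j, v 0 j != 0.
    apply/existsP; apply: contraNT v0; rewrite negb_exists => /forallP v0.
    by apply/eqP/rowP => j; rewrite mxE; have := v0 j; rewrite negbK => /eqP.
  rewrite (bigD1 j)//= ltr_pwDl ?normr_gt0//; exact: sumr_ge0.
rewrite -(ler_pM2r v_gt0) mulr_sumr.
apply: (@le_trans _ _ (\sum_j \sum_i `|v 0 i| * `|A i j|)).
  apply: ler_sum => j _; have /matrixP/(_ 0 j) := vA; rewrite !mxE -normrM => <-.
  apply: le_trans (ler_norm_sum _ _ _) _.
  by apply: ler_sum => i _; rewrite normrM.
rewrite exchange_big/= mulr_sumr; apply: ler_sum => i _.
by rewrite -mulr_sumr mulrC ler_wpM2r// row_le_mxnorm1.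
Qed.

(** * The matrix exponential and its eigenvalues *)

Section MatrixExponential.
Variable R : realType.
Local Notation C := R[i].

Lemma mx_entry_cvg m n (S : nat -> 'M[C^o]_(m, n)) (L : 'M[C^o]_(m, n)) :
  (forall i j, (S N i j : C^o) @[N --> \oo] --> (L i j : C^o)) ->
  S @ \oo --> L.
Proof.
move=> SL; apply/cvg_mx_entourageP => E entE.
apply: filter_forall => i; apply: filter_forall => j.
have /cvg_app_entourageP/(_ _ entE) := SL i j.
by apply: filterS => N /mem_set.
Qed.

(** Two-sided, so that setting one factor to [1%:M] covers [A *m expmx A], [expmx A *m A] and
    [v *m expmx A]. *)
Lemma mulmx_entry_cvg m n p q (B : 'M[C]_(m, n)) (D : 'M[C]_(p, q))
    (S : nat -> 'M[C]_(n, p)) (L : 'M[C]_(n, p)) :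
  (forall i j, (S N i j : C^o) @[N --> \oo] --> (L i j : C^o)) ->
  forall i j, ((B *m S N *m D) i j : C^o) @[N --> \oo]
    --> ((B *m L *m D) i j : C^o).
Proof.
move=> SL i j; rewrite mxE; under eq_cvg do rewrite mxE.
apply: cvg_big => [|k _]; first exact: add_continuous.
apply: cvgM; last exact: cvg_cst.
rewrite mxE; under eq_cvg do rewrite mxE.
apply: cvg_big => [|l _]; first exact: add_continuous.
by apply: cvgM; [exact: cvg_cst|exact: SL].
Qed.

Variable p : nat.
Implicit Types A : 'M[C]_p.

Definition expmx_partial A (N : nat) : 'M[C]_p :=
  series (fun k => k`!%:R^-1 *: A ^+ k) N.

(** The [limn] in [expmx] is a genuine limit only once convergence is known. Each entry is dominated
    by the real exponential series at [mxnorm1 A], and uniqueness of limits identifies the matrix of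
    entrywise limits with [expmx A]. *)
Lemma expmx_partial_entry_cvg A i j :
  (expmx_partial A N i j : C^o) @[N --> \oo] --> (expmx A i j : C^o).
Proof.
have entry_cvg k l : cvgn (fun N => expmx_partial A N k l : C^o).
  rewrite (_ : (fun _ => _) = series (fun h => h`!%:R^-1 * (A ^+ h) k l)); last first.
    apply/funext => N; rewrite /expmx_partial /series/= summxE.
    by apply: eq_bigr => h _; rewrite mxE.
  (* [mxnorm1 A] lives in [R[i]] but is nonnegative, hence equal to its real part. *)
  apply: (@series_complex_cvg _ _ (complex.Re (mxnorm1 A))) => h.
  rewrite rmorphM rmorphXn fmorphV rmorph_nat /= RRe_real ?ger0_real ?mxnorm1_ge0//.
  rewrite normrM normfV normr_nat mulrC ler_wpM2r ?invr_ge0// ?ler0n//.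
  exact: entry_exprmx_le.
pose L : 'M[C^o]_p := \matrix_(k, l) limn (fun N => expmx_partial A N k l : C^o).
have SL : (expmx_partial A : nat -> 'M[C^o]_p) @ \oo --> L.
  by apply: mx_entry_cvg => k l; rewrite mxE; exact: entry_cvg.
have -> : expmx A = L by exact: (cvg_lim (@norm_hausdorff _ _) SL).
by rewrite mxE; exact: entry_cvg.
Qed.

Lemma expmx_comm A : A *m expmx A = expmx A *m A.
Proof.
apply/matrixP => i j.
have := @mulmx_entry_cvg _ _ _ _ A 1%:M _ _ (@expmx_partial_entry_cvg A) i j.
have := @mulmx_entry_cvg _ _ _ _ 1%:M A _ _ (@expmx_partial_entry_cvg A) i j.
under eq_cvg do rewrite mul1mx.
under [X in _ -> X -> _]eq_cvg => N.
  rewrite mulmx1 (_ : A *m _ = expmx_partial A N *m A); first over.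
  rewrite /expmx_partial /series/= mulmx_sumr mulmx_suml.
  apply: eq_bigr => k _; rewrite -scalemxAl -scalemxAr; congr (_ *: _).
  by rewrite -[A *m _]exprS -[_ *m A]exprSr.
rewrite mulmx1 mul1mx => h1 h2; exact: (norm_cvg_unique h2 h1).
Qed.

Lemma eigenvector_expmx A (v : 'rV[C]_p) l : v *m A = l *: v ->
  exists2 e : C, Normc.normc e = expR (complex.Re l) & v *m expmx A = e *: v.
Proof.
move=> vA.
have cl : cvgn (series (expterm l) : nat -> C^o).
  apply: (@series_complex_cvg _ _ (Normc.normc l)) => k.
  rewrite /expterm normrM normfV normr_nat normrX.
  by rewrite rmorphM rmorphXn fmorphV rmorph_nat.
exists (limn (series (expterm l) : nat -> C^o)); first exact: norm_exp_limit.
apply/rowP => j.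
have := @mulmx_entry_cvg _ _ _ _ v 1%:M _ _ (@expmx_partial_entry_cvg A) 0 j.
under eq_cvg => N.
  rewrite mulmx1 (_ : v *m _ = series (expterm l) N *: v); last first.
    rewrite /expmx_partial /series/= mulmx_sumr scaler_suml.
    apply: eq_bigr => k _; rewrite -scalemxAr /expterm mulrC -scalerA.
    congr (_ *: _); elim: k => [|k IH]; first by rewrite !expr0 mulmx1 scale1r.
    by rewrite !exprSr mulmxA IH -scalemxAl vA scalerA.
  rewrite mxE; over.
rewrite mulmx1 mxE [in RHS]mxE => h.
by apply: (norm_cvg_unique h); apply: cvgM; [exact: cl|exact: cvg_cst].
Qed.

Lemma eigenvalue_expmxP A (e : C) : eigenvalue (expmx A) e ->
  exists2 l, eigenvalue A l & Normc.normc e = expR (complex.Re l).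
Proof.
move=> eig_e; pose W := row_base (eigenspace (expmx A) e).
have W_stable : (W *m A <= W)%MS.
  have := @comm_mx_stable_eigenspace _ _ (expmx A) A e (esym (expmx_comm A)).
  by rewrite stablemx_row_base.
have r_gt0 : (0 < \rank (eigenspace (expmx A) e))%N by rewrite lt0n mxrank_eq0.
(* This is the matrix, in the basis [W], of [A] restricted to the eigenspace; it has an eigenvalue
   because [R[i]] is algebraically closed. *)
have [l /eigenvalueP[u uB u0]] := eigenvalue_closed (W *m A *m pinvmx W) r_gt0.
have uW0 : u *m W != 0 by rewrite mulmx_free_eq0 ?row_base_free.
have uWA : u *m W *m A = l *: (u *m W).
  by rewrite -mulmxA -(mulmxKpV W_stable) mulmxA uB scalemxAl.
have uWe : u *m W *m expmx A = e *: (u *m W).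
  by apply/eigenspaceP; apply: submx_trans (submxMl _ _) _; rewrite eq_row_base.
have [e' e'l uWe'] := eigenvector_expmx uWA.
exists l; first by apply/eigenvalueP; exists (u *m W).
(* The nonzero vector [u *m W] is an eigenvector of [expmx A] for both [e] and [e']. *)
suff /eqP -> : e == e' by [].
have /eqP : (e - e') *: (u *m W) = 0 by rewrite scalerBl -uWe -uWe' subrr.
by rewrite scaler_eq0 (negPf uW0) orbF subr_eq0.
Qed.

Lemma eigenvalue_expmx A l : eigenvalue A l ->
  exists2 e, eigenvalue (expmx A) e & Normc.normc e = expR (complex.Re l).
Proof.
move=> /eigenvalueP[v vA v0]; have [e el ve] := eigenvector_expmx vA.
by exists e => //; apply/eigenvalueP; exists v.
Qed.

End MatrixExponential.

Lemma map_mxrow (S T : Type) (f : S -> T) m q (q_ : 'I_q -> nat)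
    (B : forall j, 'M[S]_(m, q_ j)) :
  map_mx f (\mxrow_j B j) = \mxrow_j map_mx f (B j).
Proof. by apply/matrixP => i j; rewrite !mxE. Qed.

(** * Real symmetric matrices as Hermitian forms *)

Section HermitianForms.
Variable R : realType.
Local Notation toC := (map_mx (real_complex R)).

Definition conjtr m n (A : 'M[R[i]]_(m, n)) : 'M[R[i]]_(n, m) :=
  (map_mx (@conjc R) A)^T.

Lemma conjtrM m n p (A : 'M[R[i]]_(m, n)) (B : 'M[R[i]]_(n, p)) :
  conjtr (A *m B) = conjtr B *m conjtr A.
Proof. by rewrite /conjtr map_mxM trmx_mul. Qed.

Lemma conjtrK m n (A : 'M[R[i]]_(m, n)) : conjtr (conjtr A) = A.
Proof. by apply/matrixP => i j; rewrite !mxE conjcK. Qed.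

Lemma conjtrD m n (A B : 'M[R[i]]_(m, n)) :
  conjtr (A + B) = conjtr A + conjtr B.
Proof. by rewrite /conjtr map_mxD raddfD. Qed.

Lemma conjtrZ m n (a : R[i]) (A : 'M[R[i]]_(m, n)) :
  conjtr (a *: A) = conjc a *: conjtr A.
Proof. by rewrite /conjtr map_mxZ linearZ. Qed.

Lemma conjtr_real m n (A : 'M[R]_(m, n)) : conjtr (toC A) = toC A^T.
Proof. by apply/matrixP => i j; rewrite !mxE/= oppr0. Qed.

Lemma conjtr_row_mx m n1 n2 (A : 'M[R[i]]_(m, n1)) (B : 'M[R[i]]_(m, n2)) :
  conjtr (row_mx A B) = col_mx (conjtr A) (conjtr B).
Proof. by rewrite /conjtr map_row_mx tr_row_mx. Qed.

(** With [w = x^T + i y^T], symmetry of [H] makes the two imaginary cross terms cancel. *)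
Lemma real_form_complexE n (H : 'M[R]_n) (w : 'rV[R[i]]_n) :
  H^T = H ->
  let x := (map_mx (@complex.Re R) w)^T in
  let y := (map_mx (@complex.Im R) w)^T in
  (w *m toC H *m conjtr w) 0 0 =
  ((x^T *m H *m x) 0 0 + (y^T *m H *m y) 0 0)%:C%C.
Proof.
move=> HT x y.
have wE : w = toC x^T + 'i%C *: toC y^T.
  by apply/rowP => j; rewrite !mxE -complexE.
have wcE : conjtr w = toC x - 'i%C *: toC y.
  rewrite wE conjtrD conjtrZ !conjtr_real !trmxK.
  by rewrite (_ : conjc 'i%C = - 'i%C :> R[i]) ?scaleNr//; simpc.
have yx : y^T *m H *m x = x^T *m H *m y.
  apply/matrixP => i j; rewrite !ord1.
  transitivity ((y^T *m H *m x)^T 0 0); first by rewrite [RHS]mxE.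
  by rewrite !trmx_mul HT !trmxK mulmxA.
rewrite wcE wE mulmxDl mulmxBr !mulmxDl -!scalemxAl -!scalemxAr -!map_mxM yx.
rewrite scalerA -expr2 sqr_i scaleN1r opprD opprK addrA addrK.
by rewrite mxE !mxE rmorphD.
Qed.

Lemma posdefmx_complex n (S : 'M[R]_n) (w : 'rV[R[i]]_n) :
  posdefmx S -> w != 0 -> 0 < (w *m toC S *m conjtr w) 0 0.
Proof.
move=> [ST Spos] w0; rewrite real_form_complexE// -(rmorph0 (real_complex R)) ltcR.
set x := (map_mx (@complex.Re R) w)^T; set y := (map_mx (@complex.Im R) w)^T.
have Snneg (u : 'cV[R]_n) : 0 <= (u^T *m S *m u) 0 0.
  by have [->|/Spos/ltW//] := eqVneq u 0; rewrite mulmx0 mxE.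
have [x0|x0] := eqVneq x 0; last by rewrite ltr_pwDl ?Spos.
have [y0|y0] := eqVneq y 0; last by rewrite ltr_wpDl ?Spos.
case/eqP: w0; apply/rowP => j; rewrite mxE [LHS]complexE.
move: x0 y0 => /matrixP/(_ j 0) + /matrixP/(_ j 0); rewrite !mxE => -> ->.
by rewrite mulr0 addr0.
Qed.

Lemma negsemidefmx_complex n (S : 'M[R]_n) (w : 'rV[R[i]]_n) :
  negsemidefmx S -> (w *m toC S *m conjtr w) 0 0 <= 0.
Proof.
move=> [ST Sneg]; rewrite real_form_complexE// -(rmorph0 (real_complex R)) lecR.
by rewrite -oppr_ge0 opprD addr_ge0 ?oppr_ge0.
Qed.

End HermitianForms.

(** * From the matrix inequality to eigenvalues in the left half-plane *)

Section LMI.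
Variables (R : realType) (p d : nat) (A : int -> 'M[R]_p).
Local Notation toC := (map_mx (real_complex R)).

(** The two sums follow the two halves of [Atilde], so that they match block by block. *)
Definition coupling_symbol (z : R[i]) : 'M[R[i]]_p :=
  \sum_(j < d) z ^ (- (j%:Z - d%:Z)) *: toC (A (j%:Z - d%:Z)) +
  \sum_(j < d) z ^ (- j.+1%:Z) *: toC (A j.+1%:Z).

Lemma symbolmxE z : symbolmx d A z = toC (A 0) + coupling_symbol z.
Proof.
rewrite /symbolmx.
pose F (j : nat) := z ^ (- (j%:Z - d%:Z)) *: toC (A (j%:Z - d%:Z)).
rewrite (_ : \sum_(j < _) _ = \sum_(0 <= j < (2 * d).+1) F j); last first.
  by rewrite big_mkord.
have ddN : (d.+1 <= (2 * d).+1)%N by rewrite ltnS mul2n -addnn leq_addr.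
(* The index [j = d] stands for [k = 0]; splitting there isolates [A 0]. *)
rewrite (@big_cat_nat _ _ _ d)//=; last exact: ltnW.
rewrite [X in _ + X]big_ltn// addrCA; congr (_ + (_ + _)).
- by rewrite /F subrr oppr0 expr0z scale1r.
- by rewrite big_mkord.
rewrite -[d.+1]add0n big_addn subSS mul2n -addnn addnK big_mkord.
apply: eq_bigr => j _; rewrite /F.
by rewrite (_ : (j + d.+1)%N%:Z - d%:Z = j.+1%:Z)// addnS -addSn PoszD addrK.
Qed.

(* The choice of the last blocks makes the Cauchy-Schwarz estimates behind the
   Schur complement equalities. *)
Definition lmi_vector (z : R[i]) (v : 'rV[R[i]]_p) :=
  let u := v *m coupling_symbol z in
  row_mx (row_mx v u)
    (row_mx (\mxrow_(j < d) (z ^ (j%:Z - d%:Z) *: u))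
            (\mxrow_(j < d) (z ^ j.+1%:Z *: u))).

Lemma conj_unit_exprz (z : R[i]) (k : int) : `|z| = 1 ->
  conjc (z ^ k) = z ^ (- k).
Proof.
move=> z1; rewrite (fmorphXz (@conjc R)) -exprz_inv invc_norm z1.
by rewrite expr1n invr1 mul1r.
Qed.

(** Write [b] for the last block of [w] and [C] for the coupling symbol. Since conjugation inverts
    [z ^ k], [Atilde b^H = C u^H], so with [u = v C] the off-diagonal blocks contribute [2 u u^H].
    The blocks [-I] and [-I/(2d)] each contribute [- u u^H], and all these terms cancel. *)
Lemma lmi_vector_form (S Q : 'M[R]_p) z v : (0 < d)%N -> `|z| = 1 ->
  let w := lmi_vector z v in
  w *m toC (lmimx d A S Q) *m conjtr w =
  v *m symbolmx d A z *m toC S *m conjtr v +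
  v *m toC S *m conjtr (v *m symbolmx d A z) + v *m toC Q *m conjtr v.
Proof.
move=> d_gt0 z1; rewrite /lmi_vector/=.
set u := v *m _; set b := row_mx (mxrow _) _.
have z0 : z != 0 by rewrite -normr_eq0 z1 oner_eq0.
have AbE : toC (Atilde d A) *m conjtr b = coupling_symbol z *m conjtr u.
  rewrite /Atilde /b conjtr_row_mx map_row_mx mul_row_col mulmxDl !map_mxrow.
  rewrite /conjtr !map_mxrow !tr_mxrow !mul_mxrow_mxcol !mulmx_suml.
  by congr (_ + _); apply: eq_bigr => j _;
    rewrite -/(conjtr _) conjtrZ conj_unit_exprz// -scalemxAr -scalemxAl.
have bAE : b *m toC (Atilde d A)^T = u *m conjtr (coupling_symbol z).
  have /(congr1 (@conjtr R _ _)) := AbE.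
  by rewrite !conjtrM !conjtrK conjtr_real.
have bbE : b *m conjtr b = (2 * d%:R) *: (u *m conjtr u).
  rewrite /b conjtr_row_mx mul_row_col /conjtr !map_mxrow !tr_mxrow !mul_mxrow_mxcol.
  have unit_scale (k : int) :
      (z ^ k *: u) *m (map_mx (@conjc R) (z ^ k *: u))^T = u *m conjtr u.
    rewrite -/(conjtr _) conjtrZ (conj_unit_exprz k z1).
    rewrite -scalemxAl -scalemxAr scalerA.
    by rewrite -expfzDr// subrr expr0z scale1r.
  under eq_bigr do rewrite unit_scale.
  under [X in _ + X]eq_bigr do rewrite unit_scale.
  by rewrite !sumr_const card_ord -mulrnDr addnn -mul2n -natrM scaler_nat.
rewrite /lmimx; move: (Atilde d A) b AbE bAE bbE => At b AbE bAE bbE.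
rewrite !(map_block_mx, map_col_mx, map_row_mx, map_mx0, map_mxN, map_mx1).
rewrite map_scalar_mx/= !mul_row_block !(mul_mx_row, mul_row_col, mulmx0, addr0).
rewrite !mulmxN mulmx1 mul_mx_scalar add_row_mx addr0 !conjtr_row_mx !mul_row_col.
rewrite !mulmxBl !mulmxDl -!(mulmxA v) -!(mulmxA _ _ (conjtr v)).
have bAvE : b *m (toC At^T *m conjtr v) = u *m conjtr u.
  by rewrite mulmxA bAE -mulmxA -conjtrM.
(* The weight compensates for the [2 * d] blocks of [b]; positivity of [d] makes [2 * d]
   invertible. *)
have bbE' : (2 * d%:R)^-1%:C%C *: b *m conjtr b = u *m conjtr u.
  rewrite -scalemxAl bbE scalerA fmorphV rmorphM/= !rmorph_nat mulVf ?scale1r//.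
  by rewrite mulf_neq0 ?pnatr_eq0// -lt0n.
rewrite bAvE bbE' AbE symbolmxE; have uE : v *m coupling_symbol z = u by [].
clearbody u; move: (coupling_symbol z) uE {AbE bAE bAvE} => C uE.
rewrite mulmxDr conjtrD conjtrM uE conjtr_real !map_mxD !map_mxM/=.
rewrite !(mulmxDl, mulmxDr) !(mulmxA v C) uE -!mulmxA.
have rearrange (V : zmodType) (x1 x2 x3 x4 y q : V) :
    x1 + x2 + q + x3 + y + (x4 - y) = x1 + x3 + (x2 + x4) + q.
  by rewrite -[LHS]addrA [y + _]addrC subrK -addrA addrAC addrACA.
by rewrite subrr addr0; exact: rearrange.
Qed.

Lemma lmi_eigenvalue_Re_lt0 (S Q : 'M[R]_p) z l : (0 < d)%N -> `|z| = 1 ->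
  posdefmx S -> posdefmx Q -> negsemidefmx (lmimx d A S Q) ->
  eigenvalue (symbolmx d A z) l -> complex.Re l < 0.
Proof.
move=> d_gt0 z1 Spos Qpos Lneg /eigenvalueP[v vA v0].
have := negsemidefmx_complex (lmi_vector z v) Lneg.
rewrite lmi_vector_form// vA conjtrZ -!scalemxAl -scalemxAr.
have := posdefmx_complex Qpos v0; have := posdefmx_complex Spos v0.
move: (v *m toC S *m _) (v *m toC Q *m _) => s q s0 q0.
(* The terms [l s] and [conj l s] add up to [2 Re l s], where [s = v S v^H] is positive. *)
rewrite !mxE -mulrDl addcJ => lsq.
have {lsq q0} : 2 * (complex.Re l)%:C%C * s 0 0 < 0.
  by apply: lt_le_trans lsq; rewrite ltrDl.
rewrite -[X in X * _](_ : (2 * complex.Re l)%:C%C = _); last first.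
  by rewrite rmorphM rmorph_nat.
rewrite pmulr_llt0// -(rmorph0 (real_complex R)) ltcR pmulr_rlt0//.
Qed.
End LMI.

(** * Continuity of polynomial expressions and determinants *)

Section Continuity.

Lemma expr_continuous (K : numFieldType) (T : topologicalType) (f : T -> K^o) k :
  continuous f -> continuous (fun x => f x ^+ k : K^o).
Proof.
move=> cf x; elim: k => [|k IH]; first exact: cvg_cst.
rewrite (_ : (fun x => _) = (fun x => f x * f x ^+ k)); last first.
  by apply/funext => y; rewrite exprS.
by apply: cvgM => //; exact: cf.
Qed.

(** This is the shape of an entry of [symbol_pencil]; the multiple [*+ n] carries the Kronecker
    delta of the scalar matrix. *)
Lemma pencil_entry_continuous (K : numFieldType) (T : topologicalType)
    (f g : T -> K^o) (m n N : nat) (e : 'I_N -> nat) (a : 'I_N -> K) :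
  continuous f -> continuous g ->
  continuous (fun x => (f x ^+ m * g x) *+ n - \sum_k f x ^+ e k * a k : K^o).
Proof.
move=> cf cg x; apply: cvgB.
  by apply: cvgMn; apply: cvgM; [exact: expr_continuous|exact: cg].
apply: cvg_big => [|k _]; first exact: add_continuous.
by apply: cvgM; [exact: expr_continuous|exact: cvg_cst].
Qed.

(** The Leibniz expansion is a finite sum of finite products of entries. *)
Lemma det_continuous (K : numFieldType) (T : topologicalType) n
    (M : T -> 'M[K]_n) :
  (forall i j, continuous (fun x => M x i j : K^o)) ->
  continuous (fun x => \det (M x) : K^o).
Proof.
move=> cM x; apply: cvg_big => [|s _]; first exact: add_continuous.
apply: cvgM; first exact: cvg_cst.
apply: cvg_big => [|i _]; first exact: mul_continuous.
exact: cM.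
Qed.

Lemma complex_continuous (R : realType) (T : topologicalType) (f g : T -> R) :
  continuous f -> continuous g ->
  continuous (fun x => (f x +i* g x)%C : R[i]^o).
Proof.
move=> cf cg x.
have toC_cont (h : T -> R) : continuous h ->
    ((h y)%:C%C : R[i]^o) @[y --> x] --> ((h x)%:C%C : R[i]^o).
  move=> ch; apply: continuous_cvg; [exact: real_complex_continuous|exact: ch].
rewrite (_ : (fun x => _) = (fun x => (f x)%:C%C + 'i%C * (g x)%:C%C)); last first.
  by apply/funext => y; rewrite [LHS]complexE.
apply: cvgD; first exact: toC_cont.
by apply: cvgM; [exact: cvg_cst|exact: toC_cont].
Qed.

Lemma norm_continuous_comp (K : numFieldType) (T : topologicalType) (f : T -> K^o) :
  continuous f -> continuous (fun x => `|f x| : K^o).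
Proof. by move=> cf x; apply: cvg_norm; exact: cf. Qed.

Lemma closed_level_set (K : numFieldType) (T : topologicalType) (f : T -> K^o) c :
  continuous f -> closed [set x | f x = c].
Proof.
move=> /continuous_closedP/(_ [set c]); apply.
by apply/accessible_closed_set1/hausdorff_accessible; exact: norm_hausdorff.
Qed.

End Continuity.

(** * A rightmost eigenvalue over the unit circle *)

Section MaximalEigenvalue.
Variables (R : realType) (p d : nat) (A : int -> 'M[R]_p).
Local Notation toC := (map_mx (real_complex R)).
Local Notation C := R[i].

(* [z^d (l - A_z)], which is polynomial in [z] and [l]. *)
Definition symbol_pencil (z l : C) : 'M[C]_p :=
  (z ^+ d * l)%:M -
  \sum_(j < (2 * d).+1) z ^+ (2 * d - j) *: toC (A (j%:Z - d%:Z)).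

(** The factor [z ^+ d] clears the negative powers and is nonzero on the circle, so the determinant
    has the same zeros. *)
Lemma eigenvalue_symbolE z l : `|z| = 1 ->
  eigenvalue (symbolmx d A z) l = (\det (symbol_pencil z l) == 0).
Proof.
move=> z1; have z0 : z != 0 by rewrite -normr_eq0 z1 oner_eq0.
have -> : symbol_pencil z l = z ^+ d *: (l%:M - symbolmx d A z).
  rewrite scalerBr scale_scalar_mx; congr (_ - _).
  rewrite /symbolmx scaler_sumr; apply: eq_bigr => j _; rewrite scalerA.
  congr (_ *: _); rewrite !exprnP -expfzDr//; congr (_ ^ _).
  rewrite -subzn -1?ltnS ?ltn_ord// (_ : (2 * d)%N%:Z = d%:Z + d%:Z); last first.
    by rewrite mul2n -addnn.
  by ring.
rewrite detZ mulf_eq0 !expf_eq0 (negPf z0) !andbF orFb.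
apply/eigenvalueP/det0P => [[v vA v0]|[v v0 vA]]; exists v => //.
  by rewrite mulmxBr vA mul_mx_scalar subrr.
by apply/eqP; rewrite -mul_mx_scalar eq_sym -subr_eq0 -mulmxBr vA.
Qed.

(** As [|z ^ k| = 1], the norm of the symbol is bounded independently of [z]. *)
Lemma eigenvalue_symbol_bound z l : `|z| = 1 -> eigenvalue (symbolmx d A z) l ->
  `|l| <= (\sum_i \sum_j \sum_(k < (2 * d).+1) `|A (k%:Z - d%:Z) i j|)%:C%C.
Proof.
move=> z1 /norm_eigenvalue_le/le_trans; apply.
have zX1 (k : int) : `|z ^ k| = 1.
  by case: k => k; rewrite /exprz ?normfV normrX z1 expr1n ?invr1.
rewrite rmorph_sum; apply: ler_sum => i _.
rewrite rmorph_sum; apply: ler_sum => j _.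
rewrite summxE rmorph_sum; apply: le_trans (ler_norm_sum _ _ _) _.
by apply: ler_sum => k _; rewrite !mxE normrM zX1 mul1r normc_real.
Qed.

Lemma det_pencil_continuous (T : topologicalType) (z l : T -> C^o) :
  continuous z -> continuous l ->
  continuous ((fun x => \det (symbol_pencil (z x) (l x))) : T -> C^o).
Proof.
move=> cz cl; apply: det_continuous => i j.
rewrite (_ : (fun x => _) = (fun x => (z x ^+ d * l x) *+ (i == j) -
    \sum_(k < (2 * d).+1)
      z x ^+ (2 * d - k) * (A (k%:Z - d%:Z) i j)%:C%C)); last first.
  apply/funext => x; rewrite !mxE summxE; congr (_ - _).
  by apply: eq_bigr => k _; rewrite !mxE.
pose a k := ((A (k%:Z - d%:Z) i j)%:C%C : C).
exact: (@pencil_entry_continuous _ T z l d (i == j) _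
  (fun k : 'I_(2 * d).+1 => (2 * d - k)%N) a cz cl).
Qed.

(* A pair [(z, l)] of complex numbers is coded by [(Re z, Im z, Re l, Im l)]. *)
Let zpart (v : 'rV[R]_4) : C := (v 0 0 +i* v 0 1)%C.
Let lpart (v : 'rV[R]_4) : C := (v 0 2 +i* v 0 3)%C.

Lemma symbol_max_eigenvalue : (0 < p)%N ->
  exists z0 l0, [/\ `|z0| = 1, eigenvalue (symbolmx d A z0) l0 &
    forall z l, `|z| = 1 -> eigenvalue (symbolmx d A z) l ->
      complex.Re l <= complex.Re l0].
Proof.
move=> p_gt0.
pose G : set 'rV[R]_4 := [set v | `|zpart v| = 1] `&`
  [set v | \det (symbol_pencil (zpart v) (lpart v)) = 0].
have inG z l : `|z| = 1 -> eigenvalue (symbolmx d A z) l ->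
    exists2 v, G v & zpart v = z /\ lpart v = l.
  move=> z1 zl.
  pose s := [:: complex.Re z; complex.Im z; complex.Re l; complex.Im l].
  have zE : zpart (\row_(i < 4) s`_i) = z.
    by rewrite /zpart !mxE /=; case: (z).
  have lE : lpart (\row_(i < 4) s`_i) = l.
    by rewrite /lpart !mxE /=; case: (l).
  exists (\row_(i < 4) s`_i) => //; split; rewrite /= zE ?lE//.
  by apply/eqP; rewrite -eigenvalue_symbolE.
have part_cont (i j : 'I_4) :
    continuous (fun v : 'rV[R]_4 => (v 0 i +i* v 0 j)%C : C^o).
  by apply: complex_continuous; exact: coord_continuous.
have G_closed : closed G.
  apply: closedI.
  - apply: (@closed_level_set C _ (fun v => `|zpart v|)).
    by apply: (@norm_continuous_comp C _ zpart); exact: part_cont.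
  - apply: (@closed_level_set C).
    by apply: (@det_pencil_continuous _ zpart lpart); exact: part_cont.
have G_bounded : bounded_set G.
  pose B := \sum_i \sum_j \sum_(k < (2 * d).+1) `|A (k%:Z - d%:Z) i j|.
  (* [1] bounds the coordinates of [z] and [B] those of [l]. *)
  exists (Num.max 1 B); split=> [|x]; first exact: num_real.
  rewrite gt_max => /andP[x1 Bx] v [/= z1 /eqP]; rewrite -eigenvalue_symbolE//.
  move=> /(eigenvalue_symbol_bound z1) lB.
  have coord_le (w : C) (b : R) : `|w| <= b%:C%C -> b < x ->
      `|complex.Re w| <= x /\ `|complex.Im w| <= x.
    move=> wb bx; split; rewrite -lecR.
      by apply: le_trans (normc_ge_Re _) _; apply: le_trans wb _; rewrite lecR ltW.
    rewrite -normrN -ReiNIm; apply: le_trans (normc_ge_Re _) _.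
    rewrite normrM [`|'i%C|]normc_def/= expr0n/= expr1n add0r sqrtr1 mulr1.
    by apply: le_trans wb _; rewrite lecR ltW.
  have [v0x v1x] : `|v 0 0| <= x /\ `|v 0 1| <= x.
    by apply: (coord_le (zpart v) 1) => //; rewrite z1.
  have [v2x v3x] : `|v 0 2| <= x /\ `|v 0 3| <= x by exact: (coord_le (lpart v) B).
  have x0 : 0 <= x by apply: le_trans v0x.
  rewrite [leLHS]mx_normrE; apply/bigmax_leP; split=> // -[i j] _ /=.
  have ordE (k : 'I_4) (ltk : (k < 4)%N) : Ordinal ltk = k by exact: val_inj.
  rewrite ord1; case: j => [[|[|[|[|//]]]] ltj].
  - by rewrite (ordE 0).
  - by rewrite (ordE 1).
  - by rewrite (ordE 2).
  - by rewrite (ordE 3).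
have G_compact := bounded_closed_compact G_bounded G_closed.
have G_neq0 : G !=set0.
  (* Any point of the circle would do; at [z = 1] an eigenvalue exists because the order is
     positive. *)
  have [l l1] := eigenvalue_closed (symbolmx d A 1) p_gt0.
  by have [v Gv _] := inG 1 l (normr1 _) l1; exists v.
pose re_l (v : 'rV[R]_4) := v 0 2.
have [|v /set_mem[/= z1 /eqP]] := @compact_EVT_max _ _ re_l G G_neq0 G_compact.
  by apply: continuous_subspaceT; exact: coord_continuous.
rewrite -eigenvalue_symbolE// => zl vmax.
exists (zpart v), (lpart v); split => // z l /inG/[apply] -[w Gw [_ <-]].
by apply: (vmax w); rewrite inE.
Qed.
End MaximalEigenvalue.

(** * Spectral radius of the exponential from the real parts of eigenvalues *)

Section SpectralRadius.
Variables (R : realType) (p : nat) (A : 'M[R[i]]_p) (r : R).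
Hypotheses (p_gt0 : (0 < p)%N)
  (Re_le : forall l, eigenvalue A l -> complex.Re l <= r).

Let moduli : set R := [set Normc.normc e | e in [set e | eigenvalue (expmx A) e]].

Let moduli_ub : ubound moduli (expR r).
Proof.
by move=> _ [e /eigenvalue_expmxP[l /Re_le lr ->] <-]; rewrite ler_expR.
Qed.

(** Here [r] is any upper bound of the real parts, so one value can serve for every [z] on the
    circle. *)
Lemma spectral_radius_expmx_le : spectral_radius (expmx A) <= expR r.
Proof.
apply: ge_sup moduli_ub.
have [l /eigenvalue_expmx[e eig_e _]] := eigenvalue_closed A p_gt0.
by exists (Normc.normc e), e.
Qed.

Lemma spectral_radius_expmx_eq l : eigenvalue A l -> complex.Re l = r ->
  spectral_radius (expmx A) = expR r.
Proof.
move=> /eigenvalue_expmx[e eig_e er] lr; apply/eqP.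
(* The eigenvalue [e] arising from [l] has modulus [expR r], so the bound is attained. *)
rewrite eq_le spectral_radius_expmx_le/= -lr -er; apply: ub_le_sup.
  by exists (expR r).
by exists e.
Qed.

End SpectralRadius.

Theorem lemma2 (R : realType) (d n m : nat)
    (hd : (1 <= d)%N) (hn : (1 <= n)%N) (hm : (1 <= m)%N)
    (Theta : 'M[R]_(n * 2))
    (Theta_anti : Theta^T = - Theta) (Theta_unit : Theta \in unitmx)
    (E : int -> 'M[R]_(n * 2))
    (E_sym : forall l : int, (`|l| <= d)%N -> E l = (E (- l))^T)
    (M : 'M[R]_(m * 2, n * 2)) :
  let A := Amx Theta E M in
  (exists S Q : 'M[R]_(n * 2),
      [/\ posdefmx S, posdefmx Q & negsemidefmx (lmimx d A S Q)]) ->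
  network_stable d A.
Proof.
move=> A [S [Q [Spos Qpos Lneg]]].
have p_gt0 : (0 < n * 2)%N by rewrite muln_gt0 hn.
have [z0 [l0 [z01 eig_l0 l0_max]]] := symbol_max_eigenvalue d A p_gt0.
(* The maximum is attained at [z0], where the rightmost eigenvalue [l0] occurs; it is below 1
   because [Re l0 < 0]. *)
exists (expR (complex.Re l0)); last first.
  by rewrite expR_lt1; exact: lmi_eigenvalue_Re_lt0 Spos Qpos Lneg eig_l0.
split.
  exists z0 => //; apply: spectral_radius_expmx_eq eig_l0 _ => // l.
  exact: l0_max.
move=> _ [z z1 <-]; apply: spectral_radius_expmx_le => // l.
exact: l0_max.
Qed.
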